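(* Let $\pi_x$ be a valid possibility contour with $\alpha$-cuts $A_\alpha(x)=\{\theta:\pi_x(\theta)\ge\alpha\}$, and suppose conversely that the contour is recovered from its $\alpha$-cuts by $$\pi_x(\theta)=\sup\{\alpha\in[0,1]:\theta\in A_\alpha(x)\}.$$ Then the following are equivalent: (1) $\pi_x$ is valid and $G$-equivariant; (2) $A_\alpha$ is a $G$-equivariant $(1-\alpha)$-confidence set, i.e. $A_\alpha(gx)=gA_\alpha(x)$ (for all $g\in G$ and all $x$) and $P_\theta\{\theta\in A_\alpha(X)\}\ge1-\alpha$ (for all $\theta$), for all $\alpha\in(0,1)$.
   Context: $G$ is a group acting measurably on the sample space $\mathcal X$ and on the parameter space $\Theta$, written $x\mapsto gx$, $\theta\mapsto g\theta$. The model $\{P_\theta:\theta\in\Theta\}$ is $G$-invariant: $X\sim P_\theta$ implies $gX\sim P_{g\theta}$ for all $g\in G,\theta\in\Theta$. A data-dependent possibility contour is a family of functions $\pi_x:\Theta\to[0,1]$ with $\sup_\Theta\pi_x=1$, $x\in\mathcal X$. It is valid if $P_\theta\{\pi_X(\theta)<\alpha\}\le\alpha$ for all $\theta\in\Theta,\alpha\in[0,1]$. It is $G$-equivariant if $\pi_{gx}(g\theta)=\pi_x(\theta)$ for all $g\in G,x\in\mathcal X,\theta\in\Theta$. For $B\subseteq\Theta$, $gB=\{g\theta:\theta\in B\}$. *)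

(* Defs.v *)
From HB Require Import structures.
From mathcomp Require Import all_boot all_order all_algebra.
From mathcomp Require Import all_classical all_reals all_analysis.

Set Implicit Arguments.
Unset Strict Implicit.
Unset Printing Implicit Defensive.

Import Order.TTheory GRing.Theory Num.Theory.
Local Open Scope classical_set_scope.
Local Open Scope ring_scope.

(* A left action of a (possibly infinite) group on a measurable space.  No
   sigma-algebra is assumed on the group, so acting measurably means that every
   single transformation is measurable. *)
Definition measurable_action (G : groupType) d (T : measurableType d)
    (act : G -> T -> T) : Prop :=
  [/\ forall t, act 1%g t = t,
      forall g h t, act (g * h)%g t = act g (act h t)
    & forall g, measurable_fun [set: T] (act g)].

Section Model.
Context {R : realType} {G : groupType}.
Context {dX dT : measure_display}.
Context {X : measurableType dX} {Theta : measurableType dT}.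
Variables (actX : G -> X -> X) (actT : G -> Theta -> Theta).
Variable P : Theta -> probability X R.

(* The law of gX under P_theta is the push-forward of P_theta by g. *)
Definition invariant_model : Prop :=
  forall g theta (B : set X), measurable B ->
    pushforward (P theta) (actX g) B = P (actT g theta) B.

Variable pi : X -> Theta -> R.

(* Measurability in x makes the events {pi_X(theta) < alpha} and
   {theta \in A_alpha(X)} have a probability: off the sigma-algebra, the value
   of a measure is meaningless. *)
Definition possibility_contour : Prop :=
  [/\ forall x theta, 0 <= pi x theta <= 1,
      forall x, sup (range (pi x)) = 1
    & forall theta, measurable_fun [set: X] (fun x => pi x theta)].

Definition valid_contour : Prop :=
  forall theta (alpha : R), 0 <= alpha <= 1 ->
    (P theta [set x | (pi x theta < alpha)%R] <= alpha%:E)%E.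

Definition equivariant_contour : Prop :=
  forall g x theta, pi (actX g x) (actT g theta) = pi x theta.

Definition alpha_cut (alpha : R) (x : X) : set Theta :=
  [set theta | alpha <= pi x theta].

Definition recovered_from_cuts : Prop :=
  forall x theta,
    pi x theta = sup [set alpha : R | 0 <= alpha <= 1 /\ alpha_cut alpha x theta].

End Model.

Section SetFamily.
Context {R : realType} {G : groupType}.
Context {dX dT : measure_display}.
Context {X : measurableType dX} {Theta : measurableType dT}.

Definition equivariant_set (actX : G -> X -> X) (actT : G -> Theta -> Theta)
    (A : X -> set Theta) : Prop :=
  forall g x, A (actX g x) = actT g @` A x.

Definition confidence_set (P : Theta -> probability X R) (level : R)
    (A : X -> set Theta) : Prop :=
  forall theta, (level%:E <= P theta [set x | A x theta])%E.

End SetFamily.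

(* Main.v *)
Require Import Defs.
From HB Require Import structures.
From mathcomp Require Import all_boot all_order all_algebra.
From mathcomp Require Import all_classical all_reals all_analysis.
From mathcomp Require Import lra.

Import Order.TTheory GRing.Theory Num.Theory.
Local Open Scope classical_set_scope.
Local Open Scope ring_scope.

(** Fix [alpha] with [0 < alpha < 1].  The event that [theta] is covered by the
[alpha]-cut is the complement of the event [pi_X(theta) < alpha], so the validity
bound at level [alpha] is the coverage bound at level [1 - alpha]
([prob_lt_le_iff_coverage]); validity at the two end levels is automatic, since
the contour takes nonnegative values and the coverage bound at level [1 - 1] is
trivial.

Since every transformation of the parameter space is a bijection, equivariance
of the [alpha]-cut says that [alpha <= pi_{gx}(g theta)] and
[alpha <= pi_x(theta)] are equivalent for all [g], [x] and [theta]
([equivariant_alpha_cutE]).  This is immediate for an equivariant contour.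
Conversely, two numbers of the unit interval are equal once they lie above the
same levels of the open unit interval ([eq_of_levels]). *)

(** Two distinct numbers of the unit interval are separated by their midpoint,
which lies in the open interval; the end levels are therefore not needed. *)
Lemma eq_of_levels {R : realFieldType} {a b : R} :
  0 <= a <= 1 -> 0 <= b <= 1 ->
  (forall alpha, 0 < alpha < 1 -> (alpha <= a <-> alpha <= b)) -> a = b.
Proof.
have sep (x y : R) : 0 <= x -> y <= 1 ->
    (forall alpha, 0 < alpha < 1 -> alpha <= y -> alpha <= x) -> y <= x.
  move=> x0 y1 yx; rewrite leNgt; apply/negP => xy.
  have m01 : 0 < (x + y) / 2 < 1 by apply/andP; split; lra.
  have my : (x + y) / 2 <= y by lra.
  by have := yx _ m01 my; lra.
move=> /andP[a0 a1] /andP[b0 b1] ab; apply/eqP; rewrite eq_le.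
by apply/andP; split; apply: sep => // alpha /ab[].
Qed.

Lemma measurable_actionK {G : groupType} {d} {T : measurableType d}
    {act : G -> T -> T} : measurable_action act ->
  forall g, cancel (act g) (act g^-1%g).
Proof. by case=> act1 actM _ g t; rewrite -actM mulVg act1. Qed.

Lemma measurable_actionVK {G : groupType} {d} {T : measurableType d}
    {act : G -> T -> T} : measurable_action act ->
  forall g, cancel (act g^-1%g) (act g).
Proof. by case=> act1 actM _ g t; rewrite -actM mulgV act1. Qed.

Lemma prob_lt_le_iff_coverage {R : realType} {d} {T : measurableType d}
    (Q : probability T R) {f : T -> R} (alpha : R) :
  measurable_fun [set: T] f ->
  (Q [set x | (f x < alpha)%R] <= alpha%:E)%E <->
  ((1 - alpha)%:E <= Q [set x | (alpha <= f x)%R])%E.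
Proof.
move=> mf.
have mlt : measurable [set x | f x < alpha].
  have := mf measurableT `]-oo, alpha[%classic (measurable_itv _).
  by rewrite setTI; congr measurable.
have -> : [set x | alpha <= f x] = ~` [set x | f x < alpha].
  by apply/seteqP; split => x /=; rewrite leNgt => /negP.
rewrite probability_setC// -(fineK (fin_num_measure Q _ mlt)).
by rewrite -EFinB !lee_fin lerD2l lerN2.
Qed.

Lemma equivariant_alpha_cutE {R : realType} {G : groupType}
    {dX dT : measure_display}
    {X : measurableType dX} {Theta : measurableType dT}
    (actX : G -> X -> X) {actT : G -> Theta -> Theta} (pi : X -> Theta -> R)
    (alpha : R) : measurable_action actT ->
  equivariant_set actX actT (alpha_cut pi alpha) <->
  forall g x theta,
    alpha <= pi (actX g x) (actT g theta) <-> alpha <= pi x theta.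
Proof.
move=> hactT; split=> [eqv g x theta | eqv g x].
  have := congr1 (@^~ (actT g theta)) (eqv g x); rewrite /alpha_cut /= => ->.
  split=> [[t tA] | tA]; last by exists theta.
  by move=> /(can_inj (measurable_actionK hactT g)) <-.
apply/seteqP; split=> [theta | _ [theta tA <-]]; rewrite /alpha_cut /=.
  rewrite -{1}(measurable_actionVK hactT g theta) => /eqv tA.
  by exists (actT g^-1%g theta) => //; exact: measurable_actionVK.
exact/eqv.
Qed.

(* The contour is not assumed valid beforehand: validity is a conjunct of the
   first condition, and assuming it would make the coverage half of the
   implication from the second condition to the first one empty. *)
Theorem lemma4p8 (R : realType) (G : groupType) (dX dT : measure_display)
    (X : measurableType dX) (Theta : measurableType dT)
    (actX : G -> X -> X) (actT : G -> Theta -> Theta)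
    (P : Theta -> probability X R) (pi : X -> Theta -> R)
    (hactX : measurable_action actX) (hactT : measurable_action actT)
    (hP : invariant_model actX actT P)
    (hpi : possibility_contour pi)
    (hrec : recovered_from_cuts pi) :
  (valid_contour P pi /\ equivariant_contour actX actT pi) <->
  (forall alpha : R, 0 < alpha < 1 ->
     equivariant_set actX actT (alpha_cut pi alpha) /\
     confidence_set P (1 - alpha) (alpha_cut pi alpha)).
Proof.
have [pi01 _ mpi] := hpi.
split=> [[val eqv] alpha alpha01 | cut].
  split; first by apply/equivariant_alpha_cutE => // g x theta; rewrite eqv.
  move=> theta; apply/prob_lt_le_iff_coverage; first exact: mpi.
  by apply: val; case/andP: alpha01 => /ltW -> /ltW ->.
split=> [theta alpha /andP[] | g x theta].
  rewrite le_eqVlt => /predU1P[<- _ | alpha0].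
    rewrite (_ : [set x | _] = set0) ?measure0//.
    apply/seteqP; split=> // x /=.
    by have /andP[+ _] := pi01 x theta; rewrite leNgt => /negP.
  rewrite le_eqVlt => /predU1P[-> | alpha1].
    apply/prob_lt_le_iff_coverage; first exact: mpi.
    by rewrite subrr measure_ge0.
  apply/prob_lt_le_iff_coverage; first exact: mpi.
  by apply: (cut alpha _).2; rewrite alpha0.
apply: eq_of_levels => // alpha /cut[+ _].
by move/(equivariant_alpha_cutE _ _ _ hactT).
Qed.
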